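(* Suppose there is a number $\rho$ such that $\rho_i=\rho$ for all $i\in N$ and $\rho\ge\max\{c_{ij}: i\in N,\ j\in F\}$. Then the two-stage robust bilevel facility location problem and the two-stage robust (single-level) facility location problem have the same optimal value: $W_{\{RBO\}}=W_{\{RO\}}$.
   Context: Data: finite nonempty sets $N$ (customers) and $F$ (facilities); real numbers, all nonnegative: fixed cost $f_j$ and capacity $K_j$ for $j\in F$; demand $d_i$ and unit unmet-demand penalty $\rho_i$ for $i\in N$; unit allocation cost $c_{ij}$ for $i\in N,j\in F$; and a nonnegative integer $\Gamma$. Uncertainty set: $\mathcal U=\{s\in\{0,1\}^{F}:\sum_{j\in F}s_j\le\Gamma\}$. For $y\in\{0,1\}^F$ and $s\in\mathcal U$, let $X(y,s)$ be the set of $(x,u)\in\mathbb R^{N\times F}\times\mathbb R^{N}$ with $x\ge0$, $u\ge0$, $\sum_{i\in N}x_{ij}\le K_jy_j(1-s_j)$ for all $j\in F$, and $\sum_{j\in F}x_{ij}+u_i=d_i$ for all $i\in N$. Let $\phi(y,s)=\operatorname{argmin}\{\sum_{i\in N}u_i:(x,u)\in X(y,s)\}$. 2-stage RBO-FLP: $W_{\{RBO\}}=\min_{y\in\{0,1\}^{F}}\Big(\sum_{j}f_jy_j+\max_{s\in\mathcal U}\min_{(x,u)\in\phi(y,s)}\big(\sum_{i}\sum_{j}c_{ij}x_{ij}+\sum_{i}\rho_iu_i\big)\Big)$. 2-stage RO-FLP: $W_{\{RO\}}=\min_{y\in\{0,1\}^{F}}\Big(\sum_{j}f_jy_j+\max_{s\in\mathcal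 U}\min_{(x,u)\in X(y,s)}\big(\sum_{i}\sum_{j}c_{ij}x_{ij}+\sum_{i}\rho_iu_i\big)\Big)$. *)

(* Defs.v *)
From HB Require Import structures.
From mathcomp Require Import all_boot all_order all_algebra.
From mathcomp Require Import mathcomp_extra boolp classical_sets reals.

Set Implicit Arguments.
Unset Strict Implicit.
Unset Printing Implicit Defensive.

Import Order.TTheory GRing.Theory Num.Theory.
Local Open Scope classical_set_scope.
Local Open Scope ring_scope.

(* [is_min A m] reads "min A exists and equals m": the value is attained. *)
Definition is_min (R : realType) (A : set R) (m : R) : Prop :=
  (A `&` lbound A) m.

Definition is_max (R : realType) (A : set R) (m : R) : Prop :=
  (A `&` ubound A) m.

(* N: customers, F: facilities. *)
Record flp_data (R : realType) (N F : finType) := FlpData {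
  fixed_cost : F -> R ;
  capacity : F -> R ;
  demand : N -> R ;
  penalty : N -> R ;
  alloc_cost : N -> F -> R ;
  budget : nat ;
  fixed_cost_ge0 : forall j, 0 <= fixed_cost j ;
  capacity_ge0 : forall j, 0 <= capacity j ;
  demand_ge0 : forall i, 0 <= demand i ;
  penalty_ge0 : forall i, 0 <= penalty i ;
  alloc_cost_ge0 : forall i j, 0 <= alloc_cost i j }.

Section FacilityLocation.
Variables (R : realType) (N F : finType) (I : flp_data R N F).

(* {0,1}^F is {ffun F -> bool}; the coercion of bool to nat gives the 0/1
   values, cast into R by %:R. *)
Definition uncertainty_set : set {ffun F -> bool} :=
  [set s : {ffun F -> bool} | (\sum_(j : F) s j <= budget I)%N].

(* The pairs (x, u) of allocations and unmet demands. *)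
Definition recourse : Type := ((N -> F -> R) * (N -> R))%type.

Definition feasible (y s : {ffun F -> bool}) : set recourse :=
  [set xu | [/\ forall i j, 0 <= xu.1 i j,
                forall i, 0 <= xu.2 i,
                forall j, \sum_(i : N) xu.1 i j
                          <= capacity I j * (y j)%:R * (1 - (s j)%:R)
              & forall i, \sum_(j : F) xu.1 i j + xu.2 i = demand I i]].

Definition unmet (xu : recourse) : R := \sum_(i : N) xu.2 i.

Definition min_unmet (y s : {ffun F -> bool}) : set recourse :=
  [set xu | feasible y s xu /\
            forall xu', feasible y s xu' -> unmet xu <= unmet xu'].

Definition operating_cost (xu : recourse) : R :=
  \sum_(i : N) \sum_(j : F) alloc_cost I i j * xu.1 i j
  + \sum_(i : N) penalty I i * xu.2 i.

Definition opening_cost (y : {ffun F -> bool}) : R :=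
  \sum_(j : F) fixed_cost I j * (y j)%:R.

(* W = min_y (opening_cost y + max_(s in U) min_(xu in D y s) cost xu).
   The witnesses v y s and w y are the values of the inner min and of the max;
   they are required for every y and every s in U, so that all three levels
   of optimization attain their value. *)
Definition two_stage_value
    (D : {ffun F -> bool} -> {ffun F -> bool} -> set recourse) (W : R) : Prop :=
  exists (v : {ffun F -> bool} -> {ffun F -> bool} -> R)
         (w : {ffun F -> bool} -> R),
    [/\ forall y s, uncertainty_set s ->
          is_min [set operating_cost xu | xu in D y s] (v y s),
        forall y, is_max [set v y s | s in uncertainty_set] (w y)
      & is_min (range (fun y => opening_cost y + w y)) W].

Definition is_W_RBO : R -> Prop := two_stage_value min_unmet.

Definition is_W_RO : R -> Prop := two_stage_value feasible.

Lemma is_min_unique (A : set R) (a b : R) : is_min A a -> is_min A b -> a = b.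
Proof.
move=> [Aa la] [Ab lb].
by apply/eqP; rewrite eq_le (la _ Ab) (lb _ Aa).
Qed.

Lemma is_max_unique (A : set R) (a b : R) : is_max A a -> is_max A b -> a = b.
Proof.
move=> [Aa ua] [Ab ub].
by apply/eqP; rewrite eq_le (ub _ Aa) (ua _ Ab).
Qed.

Lemma two_stage_value_unique
    (D : {ffun F -> bool} -> {ffun F -> bool} -> set recourse) (W W' : R) :
  two_stage_value D W -> two_stage_value D W' -> W = W'.
Proof.
move=> [v [w [hv hw hW]]] [v' [w' [hv' hw' hW']]].
have ew y : w y = w' y.
  apply: is_max_unique (hw y) _; have := hw' y; congr is_max.
  apply: eq_imagel => s Us.
  exact: is_min_unique (hv' y s Us) (hv y s Us).
apply: is_min_unique hW _; have -> // : w = w' by exact: funext.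
Qed.

End FacilityLocation.

(* Main.v *)
(* Every customer can be served by every facility, so a feasible (x, u) with
   total unmet demand U and total spare capacity S can be completed directly,
   without rerouting: sending min(U, S) extra units, split proportionally to the
   unmet demands and to the spare capacities, exhausts one of the two and hence
   minimizes the unmet demand. Each extra unit trades the penalty rho for some
   c_ij <= rho, so the cost does not increase. The inner minima over X(y,s)
   (attained by compactness) and over phi(y,s) therefore coincide. *)
Require Import Defs.
From mathcomp Require Import all_boot all_order all_algebra.
From mathcomp Require Import mathcomp_extra boolp classical_sets reals.
From mathcomp Require Import topology normedtype derive ring lra.
Import Order.TTheory GRing.Theory Num.Theory.
Import numFieldNormedType.Exports.
Local Open Scope ring_scope.
Local Open Scope classical_set_scope.

Section Attainment.
Variables (R : realType) (N F : finType) (I : flp_data R N F).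
Implicit Types (y s : {ffun F -> bool}) (xu : recourse R N F).

Lemma residual_ge0 y s j : 0 <= capacity I j * (y j)%:R * (1 - (s j)%:R).
Proof. by rewrite !mulr_ge0 ?capacity_ge0 ?ler0n// subr_ge0 lern1 leq_b1. Qed.

Lemma feasible_nonempty y s : feasible I y s !=set0.
Proof.
exists (fun _ _ => 0, demand I); split => //= [i|j|i].
- exact: demand_ge0.
- by rewrite big1// residual_ge0.
- by rewrite big1// add0r.
Qed.

(** Solving the demand equations for the unmet demands leaves only the allocation free. Indexed by
    pairs, it is a point of a product space, where compactness can be argued. *)
Definition fill_in (x : N * F -> R) : recourse R N F :=
  (fun i j => x (i, j), fun i => demand I i - \sum_(j : F) x (i, j)).

Lemma fill_inK y s xu :
  feasible I y s xu -> fill_in (fun k => xu.1 k.1 k.2) = xu.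
Proof.
case: xu => x u [_ _ _ /= dem]; congr pair; apply/funext => i /=.
by rewrite -dem addrAC subrr add0r.
Qed.

Lemma coordinate_continuous (k : N * F) :
  continuous (fun x : {ptws N * F -> R} => x k).
Proof. exact: (@proj_continuous (N * F)%type (fun=> R)). Qed.

Lemma continuous_sum_fin (T : topologicalType) (K : finType)
    (f : K -> T -> R) :
  (forall k, continuous (f k)) -> continuous (fun t => \sum_(k : K) f k t).
Proof. by move=> cf; apply: continuous_big => //; exact: add_continuous. Qed.

Lemma fill_in_unmet_continuous i :
  continuous (fun x : {ptws N * F -> R} => (fill_in x).2 i).
Proof.
have csum : continuous (fun x : {ptws N * F -> R} => \sum_(j : F) x (i, j)).
  by apply: continuous_sum_fin => j; exact: coordinate_continuous.
by move=> x; exact: (cvgB (cvg_cst _) (csum x)).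
Qed.

Lemma operating_cost_continuous :
  continuous (fun x : {ptws N * F -> R} => operating_cost I (fill_in x)).
Proof.
have calloc : continuous (fun x : {ptws N * F -> R} =>
    \sum_(i : N) \sum_(j : F) alloc_cost I i j * x (i, j)).
  apply: continuous_sum_fin => i; apply: continuous_sum_fin => j x.
  exact: (cvgM (cvg_cst _) (@coordinate_continuous (i, j) x)).
have cpenalty : continuous (fun x : {ptws N * F -> R} =>
    \sum_(i : N) penalty I i * (fill_in x).2 i).
  apply: continuous_sum_fin => i x.
  exact: (cvgM (cvg_cst _) (@fill_in_unmet_continuous i x)).
by move=> x; exact: (cvgD (calloc x) (cpenalty x)).
Qed.

(** A closed subset of a box that is compact by Tychonoff: nonnegative unmet demand forces each
    [x (i, j)] to be at most [demand I i]. *)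
Lemma feasible_compact y s :
  compact ([set x | feasible I y s (fill_in x)] : set {ptws N * F -> R}).
Proof.
pose box : set {ptws N * F -> R} :=
  [set x | forall k, (`[0, demand I k.1]%classic : set R) (x k)].
have cbox : compact box.
  exact: (@tychonoff (N * F)%type (fun=> R) (fun k => `[0, demand I k.1]%classic)
    (fun k => @segment_compact R 0 (demand I k.1))).
suff /subclosed_compact clP :
    closed ([set x | feasible I y s (fill_in x)] : set {ptws N * F -> R}).
  apply: (clP _ cbox).
  move=> x [/= x0 u0 _ _] [i j] /=; rewrite in_itv/= x0/=.
  move: (u0 i); rewrite subr_ge0; apply: le_trans.
  by rewrite (bigD1 j)//= lerDl sumr_ge0.
have closed_nonneg (f : {ptws N * F -> R} -> R) :
    continuous f -> closed [set x | 0 <= f x].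
  move=> cf; apply: (@preimage_closed _ _ f [set r | 0 <= r]).
    by move=> x _; exact: cf.
  exact: closed_ge.
(* The demand equations hold by construction of [fill_in], so only weak inequalities between
   continuous functions remain. *)
have -> : [set x | feasible I y s (fill_in x)] =
  (\bigcap_(k : N * F) [set x : {ptws N * F -> R} | 0 <= x k])
  `&` (\bigcap_(i : N) [set x : {ptws N * F -> R} | 0 <= (fill_in x).2 i])
  `&` (\bigcap_(j : F) [set x : {ptws N * F -> R} |
        0 <= capacity I j * (y j)%:R * (1 - (s j)%:R) - \sum_(i : N) x (i, j)]).
  apply/seteqP; split => [x [x0 u0 cap _]|x [[x0 u0] cap]].
    split; first split; first by move=> [i j] _; exact: x0.
      by move=> i _; exact: u0.
    by move=> j _ /=; rewrite subr_ge0; exact: cap.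
  split => [i j|i|j|i] /=.
  - exact: (x0 (i, j)).
  - exact: (u0 i).
  - by rewrite -subr_ge0; exact: (cap j).
  - by rewrite addrC subrK.
apply: closedI; first apply: closedI.
- by apply: closed_bigI => k _; apply: closed_nonneg; exact: coordinate_continuous.
- by apply: closed_bigI => i _; apply: closed_nonneg; exact: fill_in_unmet_continuous.
- apply: closed_bigI => j _; apply: closed_nonneg => x.
  have csum : continuous (fun x : {ptws N * F -> R} => \sum_(i : N) x (i, j)).
    by apply: continuous_sum_fin => i; exact: coordinate_continuous.
  exact: (cvgB (cvg_cst _) (csum x)).
Qed.

Lemma min_cost_attained y s : exists2 xu, feasible I y s xu &
  forall xu', feasible I y s xu' -> operating_cost I xu <= operating_cost I xu'.
Proof.
have [|x xP xmin] := compact_EVT_min _ (@feasible_compact y s)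
    (continuous_subspaceT operating_cost_continuous).
  have [xu xuP] := feasible_nonempty y s.
  by exists (fun k => xu.1 k.1 k.2); rewrite /= (fill_inK _ _ _ xuP).
exists (fill_in x) => [|xu xuP]; first by move: xP; rewrite inE.
rewrite -(fill_inK _ _ _ xuP); apply: xmin.
by rewrite inE /= (fill_inK _ _ _ xuP).
Qed.

Lemma min_unmet_no_costlier (rho : R) y s xu :
  (forall i, penalty I i = rho) -> (forall i j, alloc_cost I i j <= rho) ->
  feasible I y s xu ->
  exists2 xu', min_unmet I y s xu' & operating_cost I xu' <= operating_cost I xu.
Proof.
case: xu => x u pen cle [/= x0 u0 cap dem].
pose k j := capacity I j * (y j)%:R * (1 - (s j)%:R).
pose slack j := k j - \sum_(i : N) x i j.
have slack0 j : 0 <= slack j by rewrite subr_ge0; exact: cap.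
pose U := \sum_(i : N) u i; pose S := \sum_(j : F) slack j.
have U0 : 0 <= U by exact: sumr_ge0.
have S0 : 0 <= S by exact: sumr_ge0.
pose t := Num.min U S.
have tU : t <= U by rewrite ge_min lexx.
have tS : t <= S by rewrite ge_min lexx orbT.
have t0 : 0 <= t by rewrite le_min U0.
(* [a] is the fraction of every unmet demand that gets served, [b] the fraction of every spare
   capacity that gets used. *)
pose a := t / U; pose b := t / S.
have share (m : R) : 0 <= m -> t <= m -> t / m * m = t.
  (* For [m = 0] the bounds [0 <= t <= m] give [t = 0], so the identity survives division by
     zero. *)
  move=> m0 tm; have [mz|mn0] := eqVneq m 0; last by rewrite divfK.
  by rewrite mz mulr0; apply/eqP; rewrite eq_le t0 -mz tm.
have aU : a * U = t by exact: share.
have bS : b * S = t by exact: share.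
have ratio_le1 (m : R) : 0 <= m -> t <= m -> t / m <= 1.
  move=> m0 tm; have [->|mn0] := eqVneq m 0; first by rewrite invr0 mulr0.
  by rewrite ler_pdivrMr ?mul1r// lt0r mn0.
have a1 : a <= 1 by exact: ratio_le1.
have b1 : b <= 1 by exact: ratio_le1.
have a0 : 0 <= a by rewrite divr_ge0.
have b0 : 0 <= b by rewrite divr_ge0.
(* At [U = 0] or [S = 0] the junk value [0^-1 = 0] makes [z] vanish, as wanted. *)
pose z i j := a * u i * (slack j / S).
have z0 i j : 0 <= z i j by rewrite !mulr_ge0 ?invr_ge0.
have zi j : \sum_(i : N) z i j = b * slack j.
  by rewrite -mulr_suml -mulr_sumr -/U aU /b; ring.
have zj i : \sum_(j : F) z i j = a * u i.
  rewrite -mulr_sumr -mulr_suml -/S.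
  (* Without spare capacity [t = b * S] vanishes, hence so does [a], and both sides are zero. *)
  have [Sz|Sn0] := eqVneq S 0; last by rewrite divff// mulr1.
  suff -> : a = 0 by rewrite !mul0r.
  by rewrite /a (_ : t = 0) ?mul0r// -bS Sz mulr0.
pose xu' : recourse R N F :=
  (fun i j => x i j + z i j, fun i => u i - a * u i).
have feas' : feasible I y s xu'.
  split => /= [i j|i|j|i].
  - exact: addr_ge0.
  - by rewrite subr_ge0 ler_piMl.
  - rewrite big_split/= zi -lerBrDl -/(k j) -/(slack j).
    by rewrite ler_piMl.
  - by rewrite big_split/= zj addrACA subrr addr0 -dem; ring.
have unmet' : unmet xu' = U - t.
  by rewrite /unmet /= sumrB -mulr_sumr -/U aU.
exists xu'; first split => //.
  move=> [x1 u1] [/= x10 u10 cap1 dem1]; rewrite unmet' /unmet /=.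
  (* If [U <= S], no demand is left unmet. Otherwise all capacity is used up, and [U - S] equals
     total demand minus total residual capacity, a lower bound on the unmet demand of any feasible
     point. *)
  rewrite /t; case: (leP U S) => US; first by rewrite subrr sumr_ge0.
  have balance (x2 : N -> F -> R) (u2 : N -> R) :
      (forall i, \sum_(j : F) x2 i j + u2 i = demand I i) ->
      \sum_(i : N) u2 i =
        \sum_(i : N) demand I i - \sum_(j : F) \sum_(i : N) x2 i j.
    move=> d2; rewrite exchange_big/= -sumrB; apply: eq_bigr => i _.
    by rewrite -d2 addrAC subrr add0r.
  rewrite (balance _ _ dem1) /U (balance _ _ dem) /S sumrB.
  have : \sum_(j : F) \sum_(i : N) x1 i j <= \sum_(j : F) k j.
    by apply: ler_sum => j _; exact: cap1.
  by lra.
(* Customer [i] receives [a * u i] extra units at unit cost at most [rho]; the right-hand side is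
   exactly the penalty saved. *)
have extra_cost : \sum_(i : N) \sum_(j : F) alloc_cost I i j * z i j
    <= \sum_(i : N) rho * (a * u i).
  apply: ler_sum => i _; rewrite -zj mulr_sumr.
  by apply: ler_sum => j _; exact: ler_wpM2r.
have new_alloc : \sum_(i : N) \sum_(j : F) alloc_cost I i j * (x i j + z i j)
    = \sum_(i : N) \sum_(j : F) alloc_cost I i j * x i j
      + \sum_(i : N) \sum_(j : F) alloc_cost I i j * z i j.
  rewrite -big_split; apply: eq_bigr => i _ /=; rewrite -big_split.
  by apply: eq_bigr => j _; rewrite /= mulrDr.
have new_penalty : \sum_(i : N) penalty I i * (u i - a * u i)
    = \sum_(i : N) penalty I i * u i - \sum_(i : N) rho * (a * u i).
  by rewrite -sumrB; apply: eq_bigr => i _; rewrite mulrBr pen.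
by rewrite /operating_cost /= new_alloc new_penalty; lra.
Qed.

End Attainment.

Theorem proposition3 (R : realType) (N F : finType)
    (hN : (0 < #|N|)%N) (hF : (0 < #|F|)%N)
    (I : flp_data R N F) (rho : R)
    (hrho : forall i : N, penalty I i = rho)
    (hmax : forall (i : N) (j : F), alloc_cost I i j <= rho) :
  exists W_RBO W_RO : R,
    [/\ is_W_RBO I W_RBO, is_W_RO I W_RO & W_RBO = W_RO].
Proof.
have opt y s : exists v, is_min [set operating_cost I xu | xu in min_unmet I y s] v
    /\ is_min [set operating_cost I xu | xu in feasible I y s] v.
  (* Completing a cost minimizer over the larger set [feasible] gives a point of [min_unmet] that is
     still optimal there, so one value serves both minima. *)
  have [xu xuP xumin] := min_cost_attained _ _ _ I y s.
  have [xu' xu'P le_xu] := min_unmet_no_costlier _ _ _ I rho y s xu hrho hmax xuP.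
  exists (operating_cost I xu'); split; split.
  - by exists xu'.
  - by move=> _ [xu2 [xu2P _] <-]; exact: (le_trans le_xu (xumin _ xu2P)).
  - by exists xu' => //; case: xu'P.
  - by move=> _ [xu2 xu2P <-]; exact: (le_trans le_xu (xumin _ xu2P)).
have [v vP] : {v : {ffun F -> bool} -> {ffun F -> bool} -> R | forall y s,
    is_min [set operating_cost I xu | xu in min_unmet I y s] (v y s) /\
    is_min [set operating_cost I xu | xu in feasible I y s] (v y s)}.
  exists (fun y s => sval (cid (opt y s))) => y s.
  exact: (svalP (cid (opt y s))).
(* The zero vector respects every budget, so the maximum ranges over a nonempty set; it also serves
   as the default opening decision in the outer minimum. *)
pose none : {ffun F -> bool} := [ffun=> false].
have noneU : (\sum_(j : F) none j <= budget I)%N.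
  by rewrite big1// => j _; rewrite ffunE.
pose worst y := [arg max_(s > none | (\sum_(j : F) s j <= budget I)%N) v y s]%O.
pose w y := v y (worst y).
have wP y : is_max [set v y s | s in uncertainty_set I] (w y).
  rewrite /w /worst; case: arg_maxP => // s sU smax; split; first by exists s.
  by move=> _ [s' s'U <-]; exact: smax.
pose y0 := [arg min_(y < none) (opening_cost I y + w y)]%O.
have y0P : is_min (range (fun y => opening_cost I y + w y)) (opening_cost I y0 + w y0).
  rewrite /y0; case: arg_minP => // y _ ymin; split; first by exists y.
  by move=> _ [y' _ <-]; exact: ymin.
(* The same [v] and [w] witness both problems, which differ only in the inner feasible set. *)
exists (opening_cost I y0 + w y0), (opening_cost I y0 + w y0); split => //;
  by exists v, w; split => // y s _; case: (vP y s).
Qed.
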